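(* $$\lim_{n \to \infty}\mathbf{Pr}\left[c\left(G\left(n, d/n\right)\right) \le 1 + \frac{4\ln^2{d}}{d} + O\left(\frac{1}{d}\right)\right] = 1.$$ Here the $O$-term is to be read as $d \to \infty$: there exist a function $r(d)$ of $d$ alone and constants $C, d_0 > 0$ with $|r(d)| \le C/d$ for all real $d \ge d_0$, such that for every fixed real $d \ge d_0$, $\mathbf{Pr}\left[c(G(n,d/n)) \le 1 + \frac{4\ln^2 d}{d} + r(d)\right] \to 1$ as $n \to \infty$.
   Context: For a positive integer $h$ and a finite simple graph $G$ with $n$ vertices and $k$ connected components, fix one vertex in each connected component of $G$, and let $\mathrm{Lip}(G;h)$ be the set of functions $f: V(G) \to \mathbb{Z}$ such that $f$ takes the value $0$ at each of the fixed vertices and $|f(x)-f(y)| \le h$ for every edge $\{x,y\} \in E(G)$. The cardinality $|\mathrm{Lip}(G;h)|$ does not depend on the choice of fixed vertices. If $k < n$, define $c(G) = \lim_{h\to\infty} \frac{1}{h}\,|\mathrm{Lip}(G;h)|^{1/(n-k)}$ (limit over positive integers $h$; this limit exists). $G(n,p)$ denotes the Erdős–Rényi random graph on $n$ vertices in which each pair of vertices is an edge independently with probability $p$. (The event that $G(n,d/n)$ has no edges, on which $c$ is undefined, has probability tending to $0$ and is irrelevant.) $\ln^2 d$ means $(\ln d)^2$. *)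

(* Defs.v *)
From mathcomp Require Import all_boot all_order all_algebra finmap.
From mathcomp Require Import all_classical all_reals all_analysis.
Set Implicit Arguments.
Unset Strict Implicit.
Unset Printing Implicit Defensive.
Import Order.TTheory GRing.Theory Num.Theory.
Import numFieldNormedType.Exports.
Local Open Scope classical_set_scope.
Local Open Scope ring_scope.

(* A finite simple graph is a set of two-element subsets of its vertex type. *)
Definition sgraph (T : finType) : Type :=
  {E : {set {set T}} | [forall e in E, #|e| == 2%N]}.

Definition adj (T : finType) (G : sgraph T) : rel T :=
  fun x y => [set x; y]%SET \in val G.

Lemma adj_sym (T : finType) (G : sgraph T) : symmetric (adj G).
Proof. by move=> x y; rewrite /adj finset.setUC. Qed.

Lemma adj_irrefl (T : finType) (G : sgraph T) : irreflexive (adj G).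
Proof.
move=> x; apply/negP => xE.
by have /forall_inP/(_ _ xE) := valP G; rewrite cards2 eqxx.
Qed.

Definition ncomp (T : finType) (G : sgraph T) : nat := n_comp (adj G) T.

(* [roots (adj G)] contains exactly one vertex of each connected component;
   these are the vertices at which the functions are required to vanish. *)
Definition Lip (T : finType) (G : sgraph T) (h : nat) : set {ffun T -> int} :=
  [set f : {ffun T -> int} | (forall x, x \in roots (adj G) -> f x = 0) /\
                            (forall x y, adj G x y -> `|f x - f y| <= h%:Z)].

(* [Lip G h] is always finite, so [fset_set] loses nothing. *)
Definition nLip (T : finType) (G : sgraph T) (h : nat) : nat :=
  #|` fset_set (Lip G h)|.

(* Meaningful when [ncomp G < #|T|]. *)
Definition lip_const (R : realType) (T : finType) (G : sgraph T) : R :=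
  limn (fun h : nat =>
    h%:R^-1 * (nLip G h)%:R `^ ((#|T| - ncomp G)%:R^-1) : R).

(* The G(n, p) law on labelled graphs; a probability when [0 <= p <= 1]. *)
Definition gnp_mass (R : realType) (n : nat) (p : R) (G : sgraph 'I_n) : R :=
  \prod_(e : {set 'I_n} | #|e| == 2%N) (if e \in val G then p else 1 - p).

Definition gnp_prob (R : realType) (n : nat) (p : R)
    (A : pred (sgraph 'I_n)) : R :=
  \sum_(G : sgraph 'I_n | A G) gnp_mass p G.

(* Main.v *)
(* Let L = ln d and s ~ (2 L / d) n. With high probability any two disjoint
   s-sets of vertices of G(n, d/n) are joined by an edge. In such a graph, the
   s lowest and the s highest vertices of an h-Lipschitz f are joined by an
   edge xy, so all but 2s vertices take values in [f x, f x + h]. Hence f is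
   determined by the exceptional set U, the vertex x, the value f x, at most
   h + 1 choices for each ordinary vertex, and at most 2h + 1 choices for each
   vertex of U given the value of its parent in a spanning forest. Since the
   roots of the components form an independent set, there are fewer than 2s of
   them, and the dominant factor is
   C(n, 2s) 2^(2s) <= (e n / s)^(2s) ~ exp (4 n L (L - ln (2L) + 1) / d),
   whose n-th root is below 1 + 4 L^2 / d with room to spare for large d; so
   the error term can be taken to be 0. *)
Require Import Defs.
From mathcomp Require Import all_boot all_order all_algebra finmap.
From mathcomp Require Import all_classical all_reals all_analysis.
From mathcomp Require Import zify lra ring.
Set Implicit Arguments.
Unset Strict Implicit.
Unset Printing Implicit Defensive.
Import Order.TTheory GRing.Theory Num.Theory.
Import numFieldNormedType.Exports.
Local Open Scope classical_set_scope.
Local Open Scope ring_scope.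

(** * Counting the Lipschitz functions of a fixed graph *)

(** An infinite [A] is harmless, since its [fset_set] is empty. As [code] is a relation, only
    existence of a code has to be shown; choice then yields an injection into [S]. *)
Lemma leq_card_fset_set_code (X : choiceType) (K : finType) (A : set X)
    (S : {pred K}) (code : X -> K -> Prop) :
  (forall x, A x -> exists2 k, k \in S & code x k) ->
  (forall x y k, A x -> A y -> code x k -> code y k -> x = y) ->
  (#|` fset_set A| <= #|S|)%N.
Proof.
move=> exk injk.
have [finA|infA] := pselect (finite_set A); last first.
  by rewrite /fset_set; case: pselect.
have memA x : x \in enum_fset (fset_set A) -> A x.
  by move=> xA; have : x \in fset_set A by []; rewrite in_fset_set// inE.
case: (pselect (exists x, A x)) => [[x0 Ax0]|noA]; last first.
  case E: (enum_fset (fset_set A)) => [//|x s].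
  by case: noA; exists x; apply: memA; rewrite E mem_head.
have [k0 _ _] := exk _ Ax0.
have /choice[c cP] : forall x, exists k, A x -> k \in S /\ code x k.
  move=> x; case: (pselect (A x)) => [Ax|nAx]; last by exists k0.
  by have [k kS ck] := exk _ Ax; exists k.
rewrite -(size_map c); have /card_uniqP <- : uniq (map c (fset_set A)).
  rewrite map_inj_in_uniq ?fset_uniq// => x y /memA Ax /memA Ay cxy.
  by apply: (injk _ _ (c x)) => //; [case: (cP x)|rewrite cxy; case: (cP y)].
apply: subset_leq_card; apply/fintype.subsetP => _ /mapP[x /memA Ax ->].
by case: (cP x).
Qed.

(** A spanning forest: [rk x] is the length of a shortest path from [x] to its root and [par x] the
    next vertex on it. Without repeated vertices such a path has fewer than [#|T|] edges. *)
Lemma root_parent (T : finType) (G : sgraph T) :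
  exists (par : T -> T) (rk : T -> nat), forall x, (rk x < #|T|)%N /\
    (x \notin roots (adj G) -> adj G x (par x) /\ (rk (par x) < rk x)%N).
Proof.
set e := adj G; have esym : connect_sym e.
  by apply: sym_connect_sym; exact: adj_sym.
pose P x n :=
  [exists t : n.-tuple T, path e x t && (last x t == fingraph.root e x)].
have PP x s : path e x s -> last x s = fingraph.root e x -> P x (size s).
  by move=> xs ls; apply/existsP; exists (in_tuple s); rewrite xs ls eqxx.
have exP x : exists n, P x n && (n < #|T|)%N.
  have /connectP[s xs ls] := connect_root e x.
  case/shortenP: xs ls => s' xs' us' _ ls'.
  exists (size s'); rewrite PP//=.
  by rewrite (leq_trans _ (max_card (mem (x :: s'))))// (card_uniqP us').
pose rk x := ex_minn (exP x).
have rkP x : P x (rk x) /\ (rk x < #|T|)%N.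
  by rewrite /rk; case: ex_minnP => m /andP[].
suff /choice[par parP] : forall x, exists y,
    x \notin roots e -> e x y /\ (rk y < rk x)%N.
  by exists par, rk => x; split; [case: (rkP x)|exact: parP].
move=> x; case: (rkP x) => Pxr rkx.
case: (boolP (x \in roots e)) => [|xr]; first by exists x.
case/existsP: Pxr => -[[|y t] /eqP /= tsz] /=
  => [/eqP lt|/andP[/andP[exy yt] /eqP lt]].
  by case/negP: xr; apply/eqP.
exists y => _; split=> //.
have ry : fingraph.root e y = fingraph.root e x.
  by apply/(fingraph.rootP esym); rewrite esym connect1.
have Py : P y (size t) by apply: PP => //; rewrite ry.
rewrite [rk y]/rk; case: ex_minnP => m _ /(_ (size t)); rewrite Py /= => mt.
by rewrite -tsz ltnS mt// (leq_trans _ rkx)// ltnW// -tsz.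
Qed.

Lemma Lip_norm_le (T : finType) (G : sgraph T) h f x :
  Lip G h f -> `|f x| <= (#|T| * h)%:Z.
Proof.
move=> [f0 fe]; have [par [rk parP]] := root_parent G.
suff H m : forall y, (rk y <= m)%N -> `|f y| <= (m * h)%:Z.
  by apply: (H #|T|); rewrite ltnW//; case: (parP x).
elim: m => [|m IH] y rym; case: (boolP (y \in roots (adj G))) => [yr|yr].
- by rewrite f0.
- by have [_ /(_ yr)[_]] := parP y; lia.
- by rewrite f0// normr0.
have [_ /(_ yr)[ey ry]] := parP y.
have /IH IHy : (rk (par y) <= m)%N by lia.
by have := fe _ _ ey; lia.
Qed.

(** Greedy choice: move a minimiser of [f] on the rest of [D] into [A], [s] times. Applied to [- f]
    it selects the highest vertices. *)
Lemma lowest_subset (T : finType) (f : T -> int) (D : {set T}) s :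
  (s <= #|D|)%N -> exists A : {set T}, [/\ A \subset D, #|A| = s &
    forall x y, x \in A -> y \in D :\: A -> f x <= f y].
Proof.
elim: s => [_|s IH sD].
  exists finset.set0; split; rewrite ?finset.sub0set ?cards0// => x y.
  by rewrite inE.
have [A [AD cA Af]] := IH (ltnW sD).
have /card_gt0P[z0 z0D] : (0 < #|D :\: A|)%N.
  by rewrite cardsD (finset.setIidPr AD) cA subn_gt0.
case: (arg_minP f z0D) => z zD zmin.
exists (z |: A)%SET; split.
- by rewrite finset.subUset finset.sub1set AD andbT; case/finset.setDP: zD.
- by rewrite cardsU1 cA; case/finset.setDP: zD => _ ->.
move=> x y; rewrite !inE negb_or -!andbA => xzA /and3P[_ yA yD].
have yDA : y \in D :\: A by rewrite !inE yA.
by case/orP: xzA => [/eqP ->|xA]; [exact: zmin|exact: Af].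
Qed.

Definition cross_adjacent (T : finType) (G : sgraph T) (s : nat) :=
  forall A B : {set T}, #|A| = s -> #|B| = s -> B \subset (~: A)%SET ->
    exists x y, [/\ x \in A, y \in B & adj G x y].

Lemma cross_adjacent_ncomp (T : finType) (G : sgraph T) s :
  cross_adjacent G s -> (ncomp G < s.*2)%N.
Proof.
move=> cr; rewrite ltnNge; apply/negP => ncs.
pose D : {set T} := [set x | x \in roots (adj G)]%SET.
have cD : (s.*2 <= #|D|)%N.
  apply: leq_trans ncs _; apply: subset_leq_card.
  by apply/fintype.subsetP => x; rewrite !inE => /andP[].
(* With a constant function, [lowest_subset] merely picks an [s]-subset. *)
have [|A [AD cA _]] := @lowest_subset T (fun=> 0) D s; first by lia.
have [|B [BDA cB _]] := @lowest_subset T (fun=> 0) (D :\: A) s.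
  by rewrite cardsD (finset.setIidPr AD) cA; lia.
have dAB : B \subset (~: A)%SET.
  by apply: fintype.subset_trans BDA _; rewrite finset.setDE finset.subsetIr.
have [x [y [xA yB exy]]] := cr _ _ cA cB dAB.
have xr : x \in roots (adj G) by move/fintype.subsetP/(_ _ xA): AD; rewrite inE.
have yr : y \in roots (adj G).
  by move/fintype.subsetP/(_ _ yB): BDA; rewrite !inE => /andP[].
have : fingraph.root (adj G) x = fingraph.root (adj G) y.
  apply/fingraph.rootP; last exact: connect1.
  by apply: sym_connect_sym; exact: adj_sym.
rewrite (eqP xr) (eqP yr) => xy.
by move: exy; rewrite xy adj_irrefl.
Qed.

(** The number of values left to the code [lip_delta] at [u]. In the application [v] itself lies in
    [U], so it is tested first. *)
Definition lip_weight (T : finType) (G : sgraph T) h (U : {set T}) v u : nat :=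
  if u \in roots (adj G) then 1%N
  else if u == v then (2 * (#|T| * h)).+1
  else if u \in U then h.*2.+1 else h.+1.

(** Every non-root pays [h + 1]. A vertex of [U] pays at most 2 more, as [2h + 1 <= 2 (h + 1)], and
    [v] at most [2 #|T| + 1] more. *)
Lemma prod_lip_weight_le (T : finType) (G : sgraph T) h (U : {set T}) v :
  (\prod_u lip_weight G h U v u <=
     (#|T|.*2.+1 * 2 ^ #|U|) * h.+1 ^ (#|T| - ncomp G))%N.
Proof.
have -> : (h.+1 ^ (#|T| - ncomp G) =
    \prod_u if u \in roots (adj G) then 1 else h.+1)%N.
  rewrite (eq_bigr (fun u => if u \notin roots (adj G) then h.+1 else 1%N));
    last by move=> u _; case: ifP.
  rewrite -big_mkcond prod_nat_const; congr (_ ^ _)%N.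
  rewrite -(cardC (roots (adj G))) /ncomp /n_comp_mem.
  rewrite (@eq_card _ (predI _ _) (roots (adj G))) ?addKn//.
  by move=> x; rewrite !inE andbT.
have -> : (2 ^ #|U| = \prod_u if u \in U then 2 else 1)%N.
  by rewrite -big_mkcond prod_nat_const.
have -> : (#|T|.*2.+1 = \prod_u if u == v then #|T|.*2.+1 else 1)%N.
  by rewrite -big_mkcond big_pred1_eq.
rewrite -!big_split; apply: leq_prod => u _ /=; rewrite /lip_weight.
set n := #|T|; have ? : (n.*2 * h = 2 * (n * h))%N by nia.
by case: ifP; case: ifP; case: ifP => _ _ _; nia.
Qed.

Section LipCode.
Variables (T : finType) (G : sgraph T) (h : nat).
Variables (par : T -> T) (rk : T -> nat).
Hypothesis parP : forall x,
  x \notin roots (adj G) -> adj G x (par x) /\ (rk (par x) < rk x)%N.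

(* The offsets #|T| * h and h make the code nonnegative on [Lip G h]. *)
Definition lip_delta (U : {set T}) (v : T) (f : T -> int) u : int :=
  if u \in roots (adj G) then 0
  else if u == v then f u + (#|T| * h)%:Z
  else if u \in U then f u - f (par u) + h%:Z else f u - f v.

(** Decoding: first [f v], then all vertices by induction on [rk], since a vertex of [U] is read off
    from its parent, which has smaller rank. *)
Lemma lip_delta_inj U v (f f' : {ffun T -> int}) :
  Lip G h f -> Lip G h f' -> lip_delta U v f =1 lip_delta U v f' -> f = f'.
Proof.
move=> [f0 _] [f'0 _] E.
have Ev : f v = f' v.
  have := E v; rewrite /lip_delta eqxx.
  by case: ifP => [vr _|_ /addIr//]; rewrite f0// f'0.
suff H m u : (rk u < m)%N -> f u = f' u by apply/ffunP => u; exact: H (leqnn _).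
elim: m u => // m IH u rku.
have := E u; rewrite /lip_delta.
case: ifPn => [ur _|/parP[_ rp]]; first by rewrite f0// f'0.
case: ifP => [_ /addIr//|_].
case: ifP => _; last by rewrite Ev => /addIr.
by rewrite (IH (par u)); [move=> /addIr/addIr|exact: leq_trans rp rku].
Qed.

Lemma lip_delta_bounds (U : {set T}) v f u : Lip G h f ->
  (forall x, x \notin U -> f v <= f x <= f v + h%:Z) ->
  0 <= lip_delta U v f u < (lip_weight G h U v u)%:Z.
Proof.
move=> fL fU; rewrite /lip_delta /lip_weight.
case: ifPn => [//|/parP[/(fL.2) eu _]].
case: ifP => _; first by have := Lip_norm_le u fL; lia.
case: ifPn => [_|/fU]; last by lia.
by move: eu; lia.
Qed.

End LipCode.

Lemma Lip_concentrated (T : finType) (G : sgraph T) s h f :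
  cross_adjacent G s -> (s.*2 <= #|T|)%N -> Lip G h f ->
  exists (U : {set T}) (v : T), #|U| = s.*2 /\
    forall x, x \notin U -> f v <= f x <= f v + h%:Z.
Proof.
move=> cr sT fL.
have [|A [_ cA Af]] := @lowest_subset T f [set: T]%SET s.
  by rewrite cardsT; lia.
have [|B [BA cB Bf]] := @lowest_subset T (fun x => - f x) (~: A)%SET s.
  by rewrite finset.cardsCs finset.setCK cA; lia.
have [x [y [xA yB exy]]] := cr _ _ cA cB BA.
exists (A :|: B)%SET, x; split.
  have -> : #|(A :|: B)%SET| = (#|A| + #|B|)%N; last by rewrite cA cB addnn.
  rewrite cardsU; suff -> : (A :&: B)%SET = finset.set0 by rewrite cards0 subn0.
  by apply/eqP; rewrite finset.setIC finset.setI_eq0 finset.disjoints_subset.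
move=> z; rewrite !inE negb_or => /andP[zA zB].
have := fL.2 _ _ exy.
have : f x <= f z by apply: Af => //; rewrite !inE zA.
have : - f y <= - f z by apply: Bf => //; rewrite !inE zA zB.
by lia.
Qed.

Lemma nLip_le (T : finType) (G : sgraph T) s h :
  cross_adjacent G s -> (s.*2 <= #|T|)%N ->
  (nLip G h <= 'C(#|T|, s.*2) * #|T| *
     ((#|T|.*2.+1 * 2 ^ s.*2) * h.+1 ^ (#|T| - ncomp G)))%N.
Proof.
move=> cr sT; have [par [rk parP']] := root_parent G.
have parP x := (parP' x).2.
(* A common bound for all weights, so that codes live in one finite type. *)
pose N := (2 * (#|T| * h) + h.*2)%N.
pose W U v u := [pred i : 'I_N.+1 | (i < lip_weight G h U v u)%N].
pose S := [pred k : ({set T} * T) * {ffun T -> 'I_N.+1} |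
  (#|k.1.1| == s.*2) && (k.2 \in family (W k.1.1 k.1.2))].
have WN U v u : (lip_weight G h U v u <= N.+1)%N.
  by rewrite /lip_weight /N; do ![case: ifP => _]; lia.
have cW U v u : #|W U v u| = lip_weight G h U v u.
  rewrite -sum1_card -(big_ord_widen _ (fun=> 1%N) (WN U v u)).
  by rewrite sum1_card card_ord.
apply: (@leq_trans #|S|).
  pose code (f : {ffun T -> int}) (k : ({set T} * T) * {ffun T -> 'I_N.+1}) :=
    forall u, (k.2 u)%:Z = lip_delta G h par k.1.1 k.1.2 f u.
  apply: (@leq_card_fset_set_code _ _ _ S code).
    move=> f fL; have [U [v [cU fU]]] := Lip_concentrated cr sT fL.
    have bd u := lip_delta_bounds parP u fL fU.
    have gE u : (inord `|lip_delta G h par U v f u| : 'I_N.+1) =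
        `|lip_delta G h par U v f u|%N :> nat.
      rewrite inordK//; move: (bd u) (WN U v u).
      by move: (lip_delta _ _ _ _ _ _ _) (lip_weight _ _ _ _ _) => D w; lia.
    exists ((U, v), [ffun u => inord `|lip_delta G h par U v f u|]).
      rewrite inE cU eqxx /=; apply/familyP => u; rewrite ffunE inE gE.
      move: (bd u) => /=.
      by move: (lip_delta _ _ _ _ _ _ _) (lip_weight _ _ _ _ _) => D w; lia.
    move=> u /=; rewrite ffunE gE; move: (bd u).
    by move: (lip_delta _ _ _ _ _ _ _) (lip_weight _ _ _ _ _) => D w; lia.
  move=> f f' [[U v] g] fL f'L fk f'k.
  apply: (lip_delta_inj parP fL f'L) => u.
  exact: etrans (esym (fk u)) (f'k u).
(* Sum over [(U, v)] outside: there are ['C(#|T|, s.*2) * #|T|] such pairs, each with at most [M]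
   offset functions. *)
rewrite -sum1_card -(pair_big_dep (fun p : {set T} * T => #|p.1| == s.*2)
  (fun p g => g \in family (W p.1 p.2)) (fun _ _ => 1%N)) /=.
set M := (X in (_ <= _ * _ * X)%N).
apply: (@leq_trans (\sum_(p : {set T} * T | #|p.1| == s.*2) M)%N).
  apply: leq_sum => -[U v] /= /eqP cU.
  rewrite sum1_card card_family /M -cU.
  apply: leq_trans (prod_lip_weight_le G h U v).
  by rewrite foldrE big_image /=; apply: leq_prod => u _; rewrite cW.
rewrite sum_nat_const leq_mul// -card_draws -cardsT -cardsX.
apply: subset_leq_card; apply/fintype.subsetP => -[U v] /eqP cU.
by rewrite !inE /= cU eqxx.
Qed.

(** * Probabilities in the random graph *)

Section Gnp.
Variables (R : realType) (n : nat) (p : R).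

(** Expand the product of [a e + b e] over all sets [E] of chosen factors [a e]. Since [a] vanishes
    on [F] and on sets that are not pairs, only edge sets of graphs avoiding [F] survive, with
    weight [gnp_mass]. Empty [F] gives total mass 1. *)
Lemma gnp_prob_avoid (F : {set {set 'I_n}}) :
  (forall e, e \in F -> #|e| == 2%N) ->
  gnp_prob p (fun G : sgraph 'I_n => val G \subset (~: F)%SET) =
  (1 - p) ^+ #|F|.
Proof.
move=> F2.
pose a (e : {set 'I_n}) : R := if (#|e| == 2%N) && (e \notin F) then p else 0.
pose b (e : {set 'I_n}) : R := if #|e| == 2%N then 1 - p else 1.
have -> : (1 - p) ^+ #|F| = \prod_e (a e + b e).
  rewrite -prodr_const big_mkcond; apply: eq_bigr => e _; rewrite /a /b.
  case: ifPn => [eF|_]; first by rewrite andbF F2// add0r.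
  by rewrite andbT; case: ifP => _; rewrite ?add0r//; ring.
pose Q (E : {set {set 'I_n}}) :=
  [forall e in E, #|e| == 2%N] && (E \subset (~: F)%SET).
rewrite bigA_distr (bigID Q) /= [X in _ + X]big1 ?addr0; last first.
  move=> E; rewrite negb_and => /orP[/forallPn[e]|/subsetPn[e eE]].
    rewrite negb_imply => /andP[eE e2].
    by rewrite (bigD1 e)//= eE /a (negbTE e2) mul0r.
  by rewrite inE negbK => eF; rewrite (bigD1 e)//= eE /a eF andbF mul0r.
rewrite (reindex_omap (val : sgraph 'I_n -> _) insub); last first.
  by move=> E /andP[E2 _]; rewrite insubT.
apply: eq_big => [G|G GF].
  by rewrite /Q valK eqxx andbT (valP G).
rewrite /gnp_mass big_mkcond; apply: eq_bigr => e _; rewrite /a /b.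
case: (boolP (e \in val G)) => [eG|//].
have -> : #|e| == 2%N by have /forall_inP/(_ _ eG) := valP G.
by have := fintype.subsetP GF _ eG; rewrite inE => ->.
Qed.

Lemma gnp_prob_total : gnp_prob p (fun _ : sgraph 'I_n => true) = 1.
Proof.
rewrite -(expr0 (1 - p)) -(cards0 {set 'I_n}) -gnp_prob_avoid.
  by apply: eq_bigl => G; rewrite finset.setC0 finset.subsetT.
by move=> e; rewrite inE.
Qed.

Hypothesis p01 : 0 <= p <= 1.

Lemma gnp_mass_ge0 (G : sgraph 'I_n) : 0 <= gnp_mass p G.
Proof.
case/andP: p01 => p0 p1; apply: prodr_ge0 => e _.
by case: ifP; rewrite ?subr_ge0.
Qed.

Lemma gnp_prob_le (A B : pred (sgraph 'I_n)) :
  (forall G, A G -> B G) -> gnp_prob p A <= gnp_prob p B.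
Proof.
move=> AB; rewrite /gnp_prob [leRHS](bigID A)/=.
rewrite (eq_bigl A) => [|G]; last first.
  by case: (boolP (A G)) => [/AB ->//|]; rewrite andbF.
by rewrite lerDl sumr_ge0// => G _; exact: gnp_mass_ge0.
Qed.

Lemma gnp_prob_le1 (A : pred (sgraph 'I_n)) : gnp_prob p A <= 1.
Proof. by rewrite -gnp_prob_total; exact: gnp_prob_le. Qed.

Definition cross_pairs (A B : {set 'I_n}) : {set {set 'I_n}} :=
  [set [set x; y]%SET | x in A, y in B]%SET.

(** Disjointness makes each [{x, y}] a genuine pair and tells which of its elements lies in [A]. *)
Lemma cross_pairsP (A B : {set 'I_n}) : B \subset (~: A)%SET ->
  #|cross_pairs A B| = (#|A| * #|B|)%N /\
  forall e, e \in cross_pairs A B -> #|e| == 2%N.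
Proof.
move=> BA; have AB x y : x \in A -> y \in B -> (x == y) = false.
  by move=> xA /(fintype.subsetP BA); rewrite inE; apply: contraNF => /eqP <-.
split; last first.
  by move=> _ /imset2P[x y xA yB ->]; rewrite cards2 AB.
rewrite /cross_pairs curry_imset2X card_in_imset ?cardsX//.
move=> [x y] [x' y']; rewrite !inE /= => /andP[xA yB] /andP[x'A y'B] E.
have : x \in [set x'; y']%SET by rewrite -E !inE eqxx.
rewrite !inE (AB _ _ xA y'B) orbF => /eqP ->.
have : y \in [set x'; y']%SET by rewrite -E !inE eqxx orbT.
by rewrite !inE eq_sym (AB _ _ x'A yB) => /eqP ->.
Qed.

(** Union bound over the at most ['C(n, s) ^ 2] pairs of disjoint [s]-sets; each pair has no edge
    across with probability [(1 - p) ^+ (s ^ 2)]. *)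
Lemma gnp_prob_cross_adjacent s :
  1 - ('C(n, s) ^ 2)%:R * (1 - p) ^+ (s ^ 2) <=
  gnp_prob p (fun G : sgraph 'I_n => `[< cross_adjacent G s >]).
Proof.
pose Q := [pred q : {set 'I_n} * {set 'I_n} |
  [&& #|q.1| == s, #|q.2| == s & q.2 \subset (~: q.1)%SET]].
pose avoid (G : sgraph 'I_n) (q : {set 'I_n} * {set 'I_n}) :=
  val G \subset (~: cross_pairs q.1 q.2)%SET.
have tot := gnp_prob_total; move: tot; rewrite /gnp_prob.
rewrite (bigID (fun G : sgraph 'I_n => `[< cross_adjacent G s >]))/= => E.
rewrite lerBlDr -[leLHS]E lerD2l.
(* Each failing graph is counted at least once, for any pair [q] witnessing its failure. *)
apply: (@le_trans _ _
  (\sum_(G : sgraph 'I_n) \sum_(q | Q q && avoid G q) gnp_mass p G)).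
  rewrite big_mkcond; apply: ler_sum => G _; case: ifPn => [/asboolPn ncr|_].
    have [q Qq aq] : exists2 q, Q q & avoid G q.
      apply: contrapT => nq; apply: ncr => A B cA cB BA.
      apply: contrapT => nxy; apply: nq; exists (A, B).
        by rewrite !inE cA cB BA !eqxx.
      apply/fintype.subsetP => e eG; rewrite inE; apply/negP.
      move=> /imset2P[x y xA yB eE]; apply: nxy; exists x, y; split=> //.
      by rewrite /adj -eE.
    rewrite (bigD1 q) ?Qq ?aq//= lerDl sumr_ge0// => q' _; exact: gnp_mass_ge0.
  by rewrite sumr_ge0// => q _; exact: gnp_mass_ge0.
rewrite (exchange_big_dep Q)/=; last by move=> G q _ /andP[].
have cQ : (#|Q| <= 'C(n, s) ^ 2)%N.
  rewrite -[in leqRHS](card_ord n) -mulnn -card_draws -cardsX.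
  apply: subset_leq_card; apply/fintype.subsetP => -[A B].
  by rewrite !inE /= => /and3P[-> -> _].
apply: (@le_trans _ _ (\sum_(q | Q q) (1 - p) ^+ (s ^ 2))); last first.
  rewrite sumr_const -[leLHS]mulr_natl ler_wpM2r ?ler_nat// exprn_ge0//.
  by rewrite subr_ge0; case/andP: p01.
apply: ler_sum => -[A B] /and3P[/= /eqP cA /eqP cB BA].
have [cAB e2] := cross_pairsP BA.
have := gnp_prob_avoid e2; rewrite cAB cA cB mulnn => <-.
by rewrite /gnp_prob /avoid !eqxx BA.
Qed.

End Gnp.

(** * From counts to the limit constant *)

(** With [m = #|T| - ncomp G], the count is at most [(B (h + 1)) ^ m], so the sequence is at most
    [B (h + 1) / h], which tends to [B]. *)
Lemma lip_const_le (R : realType) (T : finType) (G : sgraph T)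
    (N : nat) (B : R) :
  (ncomp G < #|T|)%N -> 0 <= B ->
  (forall h, nLip G h <= N * h.+1 ^ (#|T| - ncomp G))%N ->
  N%:R <= B ^+ (#|T| - ncomp G) -> lip_const R G <= B.
Proof.
rewrite -subn_gt0 /lip_const; set m := (#|T| - ncomp G)%N => m0 B0 Nh NB.
set u := (fun h : nat => _).
pose g (h : nat) : R := h%:R^-1 * (B * h.+1%:R).
have ug h : u h <= g h.
  rewrite /u /g ler_wpM2l ?invr_ge0//.
  have -> : B * h.+1%:R = ((B * h.+1%:R) ^+ m) `^ m%:R^-1.
    rewrite -powR_mulrn ?mulr_ge0// -powRrM mulfV ?powRr1 ?mulr_ge0//.
    by rewrite pnatr_eq0 -lt0n.
  rewrite ge0_ler_powR ?invr_ge0 ?nnegrE ?exprn_ge0 ?mulr_ge0//.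
  apply: (@le_trans _ _ (N * h.+1 ^ m)%:R); first by rewrite ler_nat Nh.
  by rewrite natrM natrX exprMn ler_wpM2r ?exprn_ge0.
have gB : g @ \oo --> B.
  (* Shifting removes the term [h = 0], whose inverse is 0 by convention. *)
  rewrite -cvg_shiftS /=.
  have -> : (fun h => g h.+1) = (fun h => B + B * harmonic h).
    apply/funext => h; rewrite /g /harmonic /=.
    have h1 : (h.+1%:R : R) != 0 by rewrite pnatr_eq0.
    by rewrite -[h.+2%:R]natr1; field.
  have : (B + B * harmonic h) @[h --> \oo] --> B + B * 0.
    by apply: cvgD; [exact: cvg_cst|apply: cvgMr; exact: cvg_harmonic].
  by rewrite mulr0 addr0.
have [cu|ncu] := pselect (cvgn u); last first.
  (* Rocq's [lim] of a divergent real sequence is the default point 0. *)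
  by rewrite (dvgP ncu).
rewrite -(cvg_lim _ gB)//; apply: ler_lim => //.
  by apply/cvg_ex; exists B.
exact: nearW.
Qed.

(** * Real estimates with [L = ln d] and [s] about [2 L n / d] *)

(** This is ['C(n, k) <= (e n / k) ^ k]: combine ['C(n, k) k! <= n ^ k] with [k ^ k / k! <= e ^ k],
    a single term of the exponential series. *)
Lemma binomial_le_exprn (R : realType) (n k : nat) (Q : R) : (0 < k)%N ->
  expR 1 * n%:R <= Q * k%:R -> 'C(n, k)%:R <= Q ^+ k.
Proof.
move=> k0 nQ; have kk : 0 < (k%:R : R) ^+ k by rewrite exprn_gt0// ltr0n.
rewrite -(ler_pM2r kk) -exprMn.
apply: (@le_trans _ _ ((expR 1 * n%:R) ^+ k)); last first.
  have en0 : 0 <= expR 1 * n%:R :> R by rewrite mulr_ge0 ?expR_ge0.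
  by rewrite lerXn2r ?nnegrE//; exact: le_trans nQ.
rewrite exprMn -expRM_natl mulr1.
have kfact : (k%:R : R) ^+ k <= k`!%:R * expR k%:R.
  have := @expR_ge1Dxn R k%:R k.-1 (ler0n _ _); rewrite prednK// => H.
  rewrite mulrC -ler_pdivrMr ?ltr0n ?fact_gt0//.
  by apply: le_trans H; rewrite lerDr.
apply: le_trans (ler_wpM2l (ler0n _ _) kfact) _.
rewrite mulrA -natrM bin_ffact mulrC ler_wpM2l ?expR_ge0//.
rewrite -natrX ler_nat ffact_prod.
rewrite -[X in (_ <= _ ^ X)%N](card_ord k) -prod_nat_const.
by apply: leq_prod => i _; rewrite leq_subr.
Qed.

Lemma expR2_le16 (R : realType) : expR 2 <= 16 :> R.
Proof.
have h : 2^-1 <= expR (- 2^-1) :> R by have := expR_ge1Dx (- 2^-1 : R); lra.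
rewrite expRN lef_pV2 ?posrE ?expR_gt0// in h.
have -> : 2 = 2^-1 * 4%:R :> R by lra.
by rewrite expRM_natr (_ : 16 = 2 ^+ 4) ?lerXn2r ?nnegrE ?expR_ge0//; lra.
Qed.

Lemma pow4_le_expR (R : realType) (d L : R) :
  d = expR L -> 200 <= L -> L ^+ 4 <= 24 * d.
Proof.
move=> dL L200; have L0 : 0 <= L by lra.
have := expR_ge1Dxn 3 L0; rewrite -dL (_ : 4`!%:R = 24 :> R)//.
by move: (L ^+ 4) => z; lra.
Qed.

(** Amounts to [e n / s <= d / e], which follows from [e ^ 2 <= 16 <= 2 L]. Thus
    ['C(n, s) <= expR ((L - 1) s)]. *)
Lemma expR1_sparse (R : realType) (d L : R) (n s : nat) :
  d = expR L -> 200 <= L -> 2 * L * n%:R <= d * s%:R ->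
  expR 1 * n%:R <= expR (L - 1) * s%:R.
Proof.
move=> dL L200 sn; rewrite expRB -dL.
have e0 : 0 < expR 1 :> R by exact: expR_gt0.
have : expR 1 * expR 1 <= 16 :> R by rewrite -expRD; exact: expR2_le16.
move: e0; move: (expR 1) => e e0 e16.
rewrite mulrAC ler_pdivlMr// mulrAC; apply: le_trans sn.
by rewrite ler_wpM2r//; lra.
Qed.

(** Here the 2 in [2 L n / d] is used: [(1 - d / n) ^ s <= expR (- 2 L)] beats the squared binomial,
    leaving [expR (- 2 s)]. *)
Lemma cross_failure_le (R : realType) (d L : R) (n s : nat) :
  d = expR L -> 200 <= L -> (0 < s)%N -> 2 * L * n%:R <= d * s%:R ->
  d <= n%:R ->
  ('C(n, s) ^ 2)%:R * (1 - d / n%:R) ^+ (s ^ 2) <= (1 + s%:R)^-1 :> R.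
Proof.
move=> dL L200 s0 sn dn; have d0 : 0 < d by rewrite dL expR_gt0.
have n0 : 0 < (n%:R : R) by exact: lt_le_trans dn.
have p1 : 0 <= 1 - d / n%:R by rewrite subr_ge0 ler_pdivrMr ?mul1r.
rewrite -mulnn natrM -expr2 -[(s ^ 2)%N]mulnn exprM.
have Cb := binomial_le_exprn s0 (expR1_sparse dL L200 sn).
have qb : (1 - d / n%:R) ^+ s <= expR (- (2 * L)).
  apply: (@le_trans _ _ (expR (- (d / n%:R)) ^+ s)).
    rewrite lerXn2r ?nnegrE ?expR_ge0//.
    by have := expR_ge1Dx (- (d / n%:R)).
  rewrite -expRM_natr ler_expR mulNr lerN2 mulrAC ler_pdivlMr//.
apply: (@le_trans _ _ ((expR (L - 1) ^+ s) ^+ 2 * expR (- (2 * L)) ^+ s)).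
  apply: ler_pM; rewrite ?exprn_ge0// ?lerXn2r ?nnegrE ?exprn_ge0 ?expR_ge0//.
rewrite -exprM mulnC exprM -exprMn -expRM_natr -expRD -expRM_natr.
have -> : (L - 1) * 2 - 2 * L = - 2 by ring.
rewrite mulNr expRN lef_pV2 ?posrE ?expR_gt0//.
by have := expR_ge1Dx (2 * s%:R : R); have := ler0n R s; lra.
Qed.

(** The factor [2 ^ (2 s)] cancels against the doubled denominator in [e n / (2 s)]. *)
Lemma patterns_le (R : realType) (d L : R) (n s : nat) :
  d = expR L -> 200 <= L -> (0 < s)%N -> 2 * L * n%:R <= d * s%:R ->
  'C(n, s.*2)%:R * 2 ^+ s.*2 <= expR ((L - 1) * s.*2%:R).
Proof.
move=> dL L200 s0 sn; have H : expR 1 * n%:R <= expR (L - 1) / 2 * s.*2%:R.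
  rewrite -muln2 natrM; apply: le_trans (expR1_sparse dL L200 sn) _.
  by rewrite le_eqVlt; apply/orP; left; apply/eqP; field.
have s20 : (0 < s.*2)%N by rewrite double_gt0.
have := binomial_le_exprn s20 H; rewrite expr_div_n ler_pdivlMr ?exprn_gt0//.
by rewrite expRM_natr.
Qed.

(** Per vertex, the left side is the entropy of [U] plus the loss from the exponent [n - 2s]. With
    [b = 4 L / d] and [y = b L], [t >= y (1 - y)] reduces the claim to [L y + L b - L y b < 1]: the
    [- 1] in [L - 1] pays for all errors. *)
Lemma growth_gap (R : realType) (d L t : R) :
  d = expR L -> 200 <= L -> t = ln (1 + 4 * L ^+ 2 / d) ->
  4 * L / d * (L - 1 + t) < t.
Proof.
move=> dL L200; set y := 4 * L ^+ 2 / d => tE.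
have d0 : 0 < d by rewrite dL expR_gt0.
have L0 : 0 < L by lra.
have y0 : 0 < y by rewrite /y divr_gt0// mulr_gt0// exprn_gt0.
have ty : y * (1 - y) <= t.
  have : ln (1 + - (y / (1 + y))) <= - (y / (1 + y)).
    by apply: le_ln1Dx; rewrite ltrN2 ltr_pdivrMr; lra.
  have -> : 1 + - (y / (1 + y)) = (1 + y)^-1 by field; lra.
  rewrite lnV ?posrE; last by lra.
  rewrite lerN2 -tE; apply: le_trans.
  by rewrite ler_pdivlMr; nra.
have cubic : L ^+ 3 / d <= 24 / 200.
  rewrite ler_pdivrMr//; have := pow4_le_expR dL L200.
  by rewrite exprS; have := exprn_gt0 3 L0; move: (L ^+ 3) => z; nra.
set b := 4 * L / d; have b0 : 0 < b by rewrite /b divr_gt0// mulr_gt0.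
have yb : y = b * L by rewrite /y /b expr2; field; lra.
have Ly : L * y <= 4 * (24 / 200).
  have -> : L * y = 4 * (L ^+ 3 / d) by rewrite /y; field; lra.
  by rewrite ler_wpM2l.
have yb1 : b <= y / 200 by rewrite yb; nra.
have y1 : y <= 1 / 200 by nra.
have Lb : L * b <= 1 / 200 by rewrite mulrC -yb.
have : y * (1 - y) * (1 - b) <= t * (1 - b) by apply: ler_wpM2r; lra.
suff : b * (L - 1) < y * (1 - y) * (1 - b) by lra.
have -> : y * (1 - y) * (1 - b) = b * (L * (1 - y) * (1 - b)).
  by rewrite yb; ring.
rewrite ltr_pM2l//; have : 0 <= L * y * b.
  by rewrite (mulr_ge0 (mulr_ge0 (ltW L0) (ltW y0)) (ltW b0)).
by lra.
Qed.

(** The gap [g] gives a surplus [expR (g n - K)], where [K] pays for rounding [s] up. It absorbs the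
    polynomial factor [3 n ^ 2] through [expR x >= x ^ 3 / 6]; hence the constant [18 = 3 * 6]. *)
Lemma entropy_bound (R : realType) (d L t : R) (n s : nat) :
  d = expR L -> 200 <= L -> t = ln (1 + 4 * L ^+ 2 / d) ->
  (0 < s)%N -> 2 * L * n%:R <= d * s%:R ->
  s%:R <= 2 * L / d * n%:R + 1 -> (s.*2 <= n)%N ->
  18 * expR (2 * (L - 1 + t)) / (t - 4 * L / d * (L - 1 + t)) ^+ 3 <= n%:R ->
  ('C(n, s.*2) * n * (n.*2.+1 * 2 ^ s.*2))%:R <=
    (1 + 4 * L ^+ 2 / d) ^+ (n - s.*2).
Proof.
move=> dL L200 tE s0 sn ns s2n; have gap := growth_gap dL L200 tE.
set g := t - _; set K := 2 * _ => nlarge.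
have g0 : 0 < g by rewrite subr_gt0.
have d0 : 0 < d by rewrite dL expR_gt0.
have y0 : 0 < 4 * L ^+ 2 / d by rewrite divr_gt0// mulr_gt0// exprn_gt0//; lra.
have t0 : 0 < t by rewrite tE ln_gt0//; lra.
have n0 : (0 < n)%N by lia.
have n0R : 0 < (n%:R : R) by rewrite ltr0n.
have -> : 1 + 4 * L ^+ 2 / d = expR t by rewrite tE lnK// posrE; lra.
rewrite -expRM_natr.
have Cb := patterns_le dL L200 s0 sn.
apply: (@le_trans _ _ (3 * n%:R ^+ 2 * expR ((L - 1) * s.*2%:R))).
  apply: (@le_trans _ _
    (3 * n%:R ^+ 2 * ('C(n, s.*2)%:R * 2 ^+ s.*2))); last first.
    by rewrite ler_wpM2l// mulr_ge0// exprn_ge0.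
  have -> : ('C(n, s.*2) * n * (n.*2.+1 * 2 ^ s.*2) =
            (n * n.*2.+1) * ('C(n, s.*2) * 2 ^ s.*2))%N by lia.
  rewrite natrM [X in _ * X <= _]natrM natrX ler_wpM2r//.
  by rewrite -natrX -natrM ler_nat -mulnn; nia.
rewrite -ler_pdivlMr ?expR_gt0// -expRN -expRD.
apply: (@le_trans _ _ (expR (g * n%:R - K))); last first.
  rewrite ler_expR natrB// -addnn natrD.
  have : (L - 1 + t) * s%:R <= (L - 1 + t) * (2 * L / d * n%:R + 1).
    by rewrite ler_wpM2l//; lra.
  rewrite /g /K.
  have -> : 4 * L / d = 2 * (2 * L / d) by ring.
  by move: (2 * L / d) => a; lra.
rewrite expRB ler_pdivlMr ?expR_gt0//.
have gn0 : 0 <= g * n%:R by rewrite mulr_ge0// ltW.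
apply: (@le_trans _ _ (g ^+ 3 * n%:R ^+ 3 / 6)); last first.
  have := expR_ge1Dxn 2 gn0; rewrite exprMn (_ : 3`!%:R = 6 :> R)//; lra.
have g30 : 0 < g ^+ 3 by rewrite exprn_gt0.
move: nlarge; rewrite ler_pdivrMr// => nlarge.
have : n%:R ^+ 2 * (18 * expR K) <= n%:R ^+ 2 * (n%:R * g ^+ 3).
  by rewrite ler_wpM2l// exprn_ge0.
by rewrite [n%:R ^+ 3]exprS; lra.
Qed.

(** * Assembling the bound *)

Theorem theorem3p2p2 (R : realType) :
  exists (r : R -> R) (C d0 : R),
    [/\ 0 < C, 0 < d0,
        (forall d : R, d0 <= d -> `|r d| <= C / d) &
        (forall d : R, d0 <= d ->
           (fun n : nat =>
              gnp_prob (d / n%:R)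
                (fun G : sgraph 'I_n =>
                   (ncomp G < n)%N &&
                   (lip_const R G <= 1 + 4 * ln d ^+ 2 / d + r d)))
             @ \oo --> (1 : R))].
Proof.
(* With zero error any positive [C] serves; [expR 200] ensures [L >= 200]. *)
exists (fun=> 0), 1, (expR 200); split; rewrite ?expR_gt0//.
  move=> d dd; rewrite normr0 divr_ge0//.
  by apply: le_trans dd; exact: expR_ge0.
move=> d dd; have d0 : 0 < d by apply: lt_le_trans dd; exact: expR_gt0.
pose L := ln d; have dL : d = expR L by rewrite lnK.
have L200 : 200 <= L by rewrite -ler_expR -dL.
have L0 : 0 < L by lra.
pose a := 2 * L / d.
have a0 : 0 < a by rewrite /a divr_gt0// mulr_gt0.
(* Ensures [2 s <= n / 2 + 2 <= n] for [n >= 8]. *)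
have a1 : a <= 1 / 4.
  rewrite /a ler_pdivrMr//; have := pow4_le_expR dL L200.
  have : 200 ^+ 3 * L <= L ^+ 4.
    by rewrite (exprSr L) ler_wpM2r ?lerXn2r ?nnegrE//; lra.
  by move: (L ^+ 4) => z; lra.
pose s n := (Num.truncn (a * n%:R)).+1.
have sgt n : a * n%:R < (s n)%:R by rewrite truncnS_gt.
have sle n : (s n)%:R <= a * n%:R + 1.
  by rewrite /s -natr1 lerD2r truncn_le// mulr_ge0// ltW.
(* The failure probability is at most [1 / (1 + s)], and [1 + s >= a (n + 1)] since [a <= 1]. *)
apply: (@squeeze_cvgr _ _ _ _ (fun n => 1 - a^-1 * harmonic n) (fun=> 1)).
- near=> n.
  have dn : d <= n%:R by near: n; exact: nbhs_infty_ger.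
  have n8 : 8 <= (n%:R : R) by near: n; exact: nbhs_infty_ger.
  have n0 : 0 < (n%:R : R) by lra.
  have p01 : 0 <= d / n%:R <= 1.
    by apply/andP; split; [rewrite divr_ge0// ltW|rewrite ler_pdivrMr ?mul1r].
  have sn : 2 * L * n%:R <= d * (s n)%:R.
    have := ltW (sgt n); rewrite /a -(ler_pM2l d0).
    by rewrite (_ : d * (2 * L / d * n%:R) = 2 * L * n%:R)//; field; lra.
  have s2n : ((s n).*2 <= n)%N.
    have := sle n; rewrite -(ler_nat R) -addnn natrD => ?.
    have : a * n%:R <= 1 / 4 * n%:R by rewrite ler_wpM2r// ltW.
    by lra.
  rewrite gnp_prob_le1// andbT.
  apply: (@le_trans _ _ (gnp_prob (d / n%:R)
      (fun G : sgraph 'I_n => `[< cross_adjacent G (s n) >]))).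
    apply: le_trans (gnp_prob_cross_adjacent _ p01 (s n)).
    rewrite lerD2l lerN2.
    apply: le_trans (cross_failure_le dL L200 _ sn dn) _ => //.
    have an0 : 0 < a * n.+1%:R by rewrite mulr_gt0.
    have s0 : 0 < 1 + (s n)%:R :> R by rewrite ltr_pwDl.
    rewrite /harmonic /= -invfM lef_pV2 ?posrE//.
    by rewrite -natr1; have := sgt n; lra.
  apply: gnp_prob_le => // G /asboolP cr.
  have cT : #|'I_n| = n by rewrite card_ord.
  have s2T : ((s n).*2 <= #|'I_n|)%N by rewrite cT.
  have kn := cross_adjacent_ncomp cr.
  have kn' : (ncomp G < n)%N by exact: leq_trans kn s2n.
  rewrite kn' addr0 /=.
  have B1 : 1 <= 1 + 4 * ln d ^+ 2 / d :> R.
    by rewrite lerDl divr_ge0 ?mulr_ge0 ?sqr_ge0 ?ltW.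
  apply: (@lip_const_le _ _ _
    ('C(n, (s n).*2) * n * (n.*2.+1 * 2 ^ (s n).*2))).
  - by rewrite cT.
  - exact: le_trans B1.
  - by move=> h; have := nLip_le h cr s2T; rewrite cT mulnA.
  rewrite cT.
  (* The exponent may drop from [n - ncomp G] to [n - 2s], as [ncomp G < 2s] and the base is at
     least 1. *)
  apply: (@le_trans _ _ ((1 + 4 * ln d ^+ 2 / d) ^+ (n - (s n).*2))).
    apply: (entropy_bound dL L200 (erefl _)) => //.
    by near: n; exact: nbhs_infty_ger.
  by rewrite ler_weXn2l// leq_sub2l// ltnW.
- have : (1 - a^-1 * harmonic n) @[n --> \oo] --> (1 - a^-1 * 0 : R).
    apply: cvgB; first exact: cvg_cst.
    by apply: cvgMr; exact: cvg_harmonic.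
  by rewrite mulr0 subr0.
exact: cvg_cst.
Unshelve. all: by end_near.
Qed.
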